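(* Let $\mathcal{H}$ be a real Hilbert space, $C\subset\mathcal{H}$ a nonempty closed convex set, $N\ge1$, and for $1\le j\le N$ let $\{T^{(j)}(t):t\ge0\}$ be a nonexpansive semigroup on $C$ such that $F=\bigcap_{1\le j\le N,\,t\ge0}\mathrm{Fix}(T^{(j)}(t))$ is nonempty. Let $(t_n)_{n\ge0}$ be a sequence of positive real numbers with $t_n\to+\infty$, and put $T^{(j)}_nx=\frac1{t_n}\int_0^{t_n}T^{(j)}(s)x\,ds$ for $x\in C$. Let $0<a<b<1$ and let $(\alpha^{(j)}_n)_{n\ge0}$, $1\le j\le N$, be real sequences with $\alpha^{(j)}_n\in(a,b)$ for $2\le j\le N$ and all $n$, and $\alpha^{(1)}_n\in[0,b)$ for all $n$. Define $\Gamma^{(N+1)}_nx=x$ and, for $j=N,\dots,1$, $\Gamma^{(j)}_nx=\alpha^{(j)}_nx+(1-\alpha^{(j)}_n)T^{(j)}_n\Gamma^{(j+1)}_nx$ for $x\in C$, and put $R_n=\Gamma^{(1)}_n$. Then the sequence $(R_n)_{n\ge0}$ satisfies the NST-condition (I) with the family $\mathcal{F}=\{T^{(j)}(t):1\le j\le N,\ t\ge0\}$, and the sequence $(T_n)_{n\ge0}$ given by $T_n=(R_n+\mathrm{Id})/2$ is a $\mathcal{T}_C$-class and coherent sequence.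
   Context: $\mathrm{Fix}(T)=\{x\in C:Tx=x\}$. A mapping $T:C\to C$ is nonexpansive if $\|Tx-Ty\|\le\|x-y\|$ for all $x,y\in C$. A nonexpansive semigroup on $C$ is a family $\{T(t):t\ge0\}$ of mappings $C\to C$ such that: (i) $T(0)x=x$ for all $x\in C$; (ii) $T(s+t)=T(s)T(t)$ for all $s,t\ge0$; (iii) for each $x\in C$, $t\mapsto T(t)x$ is continuous; (iv) $\|T(t)x-T(t)y\|\le\|x-y\|$ for all $x,y\in C$, $t\ge0$. NST-condition (I): let $(S_n)_{n\ge0}$ and $\mathcal{F}$ be two families of nonexpansive mappings of $C$ into itself such that $\emptyset\ne\mathrm{Fix}(\mathcal{F})=\bigcap_{n}\mathrm{Fix}(S_n)$, where $\mathrm{Fix}(\mathcal{F})$ is the set of common fixed points of the mappings in $\mathcal{F}$. Then $(S_n)$ satisfies the NST-condition (I) with $\mathcal{F}$ if for each bounded sequence $(z_n)$ in $C$, $\lim_n\|z_n-S_nz_n\|=0$ implies $\lim_n\|z_n-Tz_n\|=0$ for all $T\in\mathcal{F}$. $\mathcal{T}_C$-class: with $H(x,y)=\{z\in\mathcal{H}:\langle z-y,x-y\rangle\le0\}$, $\mathcal{T}_C$ is the set of mappings $T:C\to C$ such that $\mathrm{Fix}(T)\subset H(x,Tx)$ for all $x\in C$; a sequence is of $\mathcal{T}_C$-class if all its terms are in $\mathcal{T}_C$. Coherence: a sequence $(T_n)_{n\ge0}$ in $\mathcal{T}_C$ is coherent if for every bounded sequence $(z_n)_{n\ge0}$ in $C$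 with $\sum_{n\ge0}\|z_{n+1}-z_n\|^2<\infty$ and $\sum_{n\ge0}\|z_n-T_nz_n\|^2<\infty$, every weak cluster point of $(z_n)$ belongs to $\bigcap_{n\ge0}\mathrm{Fix}(T_n)$. *)

(* Defs.v *)
(* Stdlib reals with Coquelicot.  Coquelicot's Riemann integral takes values in
   an arbitrary complete normed module, hence in a Hilbert space. *)
From Stdlib Require Export Reals List Lia Lra.
From Coquelicot Require Export Coquelicot.

Set Implicit Arguments.
Unset Strict Implicit.
Unset Printing Implicit Defensive.

Open Scope R_scope.

Record HilbertSpace := {
  hilbert_module :> CompleteNormedModule R_AbsRing;
  inner : hilbert_module -> hilbert_module -> R;
  inner_sym : forall x y, inner x y = inner y x;
  inner_plus_l : forall x y z, inner (plus x y) z = inner x z + inner y z;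
  inner_scal_l : forall (c : R) x y, inner (scal c x) y = c * inner x y;
  inner_norm : forall x, inner x x = norm x ^ 2
}.

(* A mapping C -> C is encoded as a total function on H that sends C into C;
   its values outside C are irrelevant to every notion below. *)
Section Mappings.

Variable H : HilbertSpace.
Implicit Types (C : H -> Prop) (T : H -> H) (x y : H) (z : nat -> H).

Definition convex C : Prop :=
  forall x y (l : R), C x -> C y -> 0 <= l <= 1 ->
    C (plus (scal l x) (scal (1 - l) y)).

Definition self_map C T : Prop := forall x, C x -> C (T x).

Definition Fix C T x : Prop := C x /\ T x = x.

Definition common_Fix C (F : (H -> H) -> Prop) x : Prop :=
  C x /\ forall T, F T -> Fix C T x.

Definition nonexpansive C T : Prop :=
  self_map C T /\
  forall x y, C x -> C y -> norm (minus (T x) (T y)) <= norm (minus x y).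

(* Only the values of [T t] for [0 <= t] matter; continuity is relative to the
   half-line, hence one-sided at 0. *)
Definition nonexpansive_semigroup C (T : R -> H -> H) : Prop :=
  (forall t, 0 <= t -> self_map C (T t)) /\
  (forall x, C x -> T 0 x = x) /\
  (forall s t x, 0 <= s -> 0 <= t -> C x -> T (s + t) x = T s (T t x)) /\
  (forall x, C x -> continuous_on (fun t => 0 <= t) (fun t => T t x)) /\
  (forall t x y, 0 <= t -> C x -> C y ->
     norm (minus (T t x) (T t y)) <= norm (minus x y)).

Definition bounded_seq z : Prop := exists M : R, forall n, norm (z n) <= M.

Definition NST_condition_I C (S_ : nat -> H -> H) (F : (H -> H) -> Prop) : Prop :=
  (forall n, nonexpansive C (S_ n)) /\
  (forall T, F T -> nonexpansive C T) /\
  (exists x, common_Fix C F x) /\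
  (forall x, common_Fix C F x <-> forall n, Fix C (S_ n) x) /\
  (forall z, (forall n, C (z n)) -> bounded_seq z ->
     is_lim_seq (fun n => norm (minus (z n) (S_ n (z n)))) 0 ->
     forall T, F T -> is_lim_seq (fun n => norm (minus (z n) (T (z n)))) 0).

Definition halfspace x y (w : H) : Prop := inner (minus w y) (minus x y) <= 0.

Definition T_class C T : Prop :=
  self_map C T /\ forall x, C x -> forall w, Fix C T w -> halfspace x (T x) w.

Definition T_class_seq C (T_ : nat -> H -> H) : Prop :=
  forall n, T_class C (T_ n).

(* Neighbourhoods of x in the weak topology, the coarsest one making every
   [fun w => inner w u] continuous. *)
Definition weakly_locally x (U : H -> Prop) : Prop :=
  exists (us : list H) (eps : R), 0 < eps /\
    forall w, (forall u, In u us -> Rabs (inner (minus w x) u) < eps) -> U w.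

Definition weak_cluster_point z x : Prop :=
  forall U, weakly_locally x U ->
    forall n0 : nat, exists n : nat, (n0 <= n)%nat /\ U (z n).

Definition coherent C (T_ : nat -> H -> H) : Prop :=
  T_class_seq C T_ /\
  forall z, (forall n, C (z n)) -> bounded_seq z ->
    ex_series (fun n => norm (minus (z (S n)) (z n)) ^ 2) ->
    ex_series (fun n => norm (minus (z n) (T_ n (z n))) ^ 2) ->
    forall x, weak_cluster_point z x -> forall n, Fix C (T_ n) x.

(* For a nonexpansive semigroup T, x in C and t > 0, the integrand is
   continuous on [0, t], so [RInt] is the
   genuine (norm-convergent) Riemann integral. *)
Definition time_average (T : R -> H -> H) (t : R) x : H :=
  scal (/ t) (RInt (fun s => T s x) 0 t).

(* [Gamma_rec A alpha k j] composes the k steps of indices j, ..., j + k - 1. *)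
Fixpoint Gamma_rec (A : nat -> H -> H) (alpha : nat -> R) (k j : nat) x : H :=
  match k with
  | O => x
  | S k' => plus (scal (alpha j) x)
                 (scal (1 - alpha j) (A j (Gamma_rec A alpha k' (S j) x)))
  end.

(* The operator of index j, for 1 <= j <= N + 1, of the descending recursion
   characterised by [Gamma_last] and [Gamma_step]. *)
Definition Gamma (A : nat -> H -> H) (alpha : nat -> R) (N j : nat) : H -> H :=
  Gamma_rec A alpha (N + 1 - j) j.

Lemma Gamma_last A alpha N x : Gamma A alpha N (N + 1) x = x.
Proof. unfold Gamma; rewrite Nat.sub_diag; reflexivity. Qed.

Lemma Gamma_step A alpha N j x : (1 <= j <= N)%nat ->
  Gamma A alpha N j x =
  plus (scal (alpha j) x) (scal (1 - alpha j) (A j (Gamma A alpha N (j + 1) x))).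
Proof.
intros Hj; unfold Gamma.
replace (N + 1 - j)%nat with (S (N + 1 - (j + 1))) by lia.
rewrite (Nat.add_comm j 1); reflexivity.
Qed.

End Mappings.

(* Main.v *)
(** If [z n - R_n (z n)] tends to 0, the strong convexity of the squared norm,
    applied at a common fixed point to the nested convex combinations from the
    outermost inwards, gives [z n - T^(j)_n (z n) -> 0] for every [j].  The mean
    [y] of an orbit of a nonexpansive semigroup over [[0, t]] minimises the mean
    squared distance to that orbit, which forces [|y - T s y|] to be of order
    [sqrt (s / t)]; hence [z n - T^(j)(s) (z n) -> 0], which is the
    NST-condition.  Coherence follows by demiclosedness of [Id - T^(j)(s)] and
    weak closedness of [C]. *)
From Stdlib Require Import Classical.
Require Import Defs.

(** * Inner products *)

Section InnerProduct.

Variable H : HilbertSpace.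
Implicit Types (x y z w p : H) (C : H -> Prop).

Lemma inner_opp_l x y : inner (opp x) y = - inner x y.
Proof.
assert (E : opp x = scal (-1) x) by exact (eq_sym (scal_opp_one (V := H) x)).
rewrite E, inner_scal_l; ring.
Qed.

Lemma inner_minus_l x y z : inner (minus x y) z = inner x z - inner y z.
Proof. unfold minus; rewrite inner_plus_l, inner_opp_l; ring. Qed.

Lemma inner_plus_r x y z : inner x (plus y z) = inner x y + inner x z.
Proof. now rewrite inner_sym, inner_plus_l, (inner_sym y), (inner_sym z). Qed.

Lemma inner_scal_r (c : R) x y : inner x (scal c y) = c * inner x y.
Proof. now rewrite inner_sym, inner_scal_l, inner_sym. Qed.

Lemma inner_minus_r x y z : inner x (minus y z) = inner x y - inner x z.
Proof. now rewrite inner_sym, inner_minus_l, (inner_sym y), (inner_sym z). Qed.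

Lemma norm_minus_0 x y : norm (minus x y) = 0 -> x = y.
Proof.
intros E; apply (plus_reg_r (opp y)); rewrite plus_opp_r.
exact (norm_eq_zero _ E).
Qed.

(** Testing against an arbitrary vector turns identities in [H] into real ones, which [ring] or
    [field] can settle; this is how the vector algebra below is done. *)
Lemma inner_ext x y : (forall w, inner x w = inner y w) -> x = y.
Proof.
intros E; apply norm_minus_0, Rsqr_0_uniq.
rewrite Rsqr_pow2, <- inner_norm, inner_minus_l, E; ring.
Qed.

(** Cauchy-Schwarz read backwards from the triangle inequality, which the normed-module structure
    provides: square [norm (plus x y) <= norm x + norm y] and expand. *)
Lemma inner_le_norm x y : inner x y <= norm x * norm y.
Proof.
assert (Hn := norm_triangle x y).
assert (Hp := norm_ge_0 (plus x y)).
assert (E : norm (plus x y) ^ 2 = norm x ^ 2 + 2 * inner x y + norm y ^ 2).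
{ rewrite <- !inner_norm, inner_plus_l, !inner_plus_r, (inner_sym y x); ring. }
assert (Hs := pow_incr _ _ 2 (conj Hp Hn)); rewrite E in Hs; lra.
Qed.

Lemma Rabs_inner_le_norm x y : Rabs (inner x y) <= norm x * norm y.
Proof.
apply Rabs_le; split; [|apply inner_le_norm].
assert (Hn := inner_le_norm (opp x) y).
assert (E : norm (opp x) = norm x) by exact (norm_opp x).
rewrite E, inner_opp_l in Hn; lra.
Qed.

Lemma norm_minus_sym x y : norm (minus x y) = norm (minus y x).
Proof.
exact (eq_trans (eq_sym (norm_opp _)) (f_equal norm (opp_minus x y))).
Qed.

Lemma norm_minus_triangle x y z :
  norm (minus x z) <= norm (minus x y) + norm (minus y z).
Proof.
assert (E : minus x z = plus (minus x y) (minus y z)) by exact (minus_trans y x z).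
rewrite E; exact (norm_triangle _ _).
Qed.

Lemma norm_minus_le x y : norm (minus x y) <= norm x + norm y.
Proof.
assert (E : norm (opp y) = norm y) by exact (norm_opp y).
rewrite <- E; exact (norm_triangle _ _).
Qed.

Lemma norm_scal_eq (c : R) x : norm (scal c x) = Rabs c * norm x.
Proof.
apply Rsqr_inj.
- apply norm_ge_0.
- apply Rmult_le_pos; [apply Rabs_pos | apply norm_ge_0].
- rewrite Rsqr_mult, <- Rsqr_abs, !Rsqr_pow2, <- !inner_norm,
    inner_scal_l, inner_scal_r; unfold Rsqr; ring.
Qed.

(** Strong convexity of the squared norm as an exact identity; its last term is the gain that
    controls the residuals later. *)
Lemma norm_convex_comb_sqr (l : R) x y p :
  norm (minus (plus (scal l x) (scal (1 - l) y)) p) ^ 2 =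
  l * norm (minus x p) ^ 2 + (1 - l) * norm (minus y p) ^ 2
  - l * (1 - l) * norm (minus x y) ^ 2.
Proof.
rewrite <- !inner_norm, !inner_minus_l, !inner_minus_r, !inner_plus_l,
  !inner_plus_r, !inner_scal_l, !inner_scal_r, (inner_sym y x),
  (inner_sym p x), (inner_sym p y).
ring.
Qed.

Lemma norm_minus_sqr_shift x y z :
  norm (minus x z) ^ 2 =
  norm (minus x y) ^ 2 + 2 * inner (minus x y) (minus y z) + norm (minus y z) ^ 2.
Proof.
rewrite <- !inner_norm, !inner_minus_l, !inner_minus_r, (inner_sym z x),
  (inner_sym y x), (inner_sym z y).
ring.
Qed.

Lemma minus_convex_comb (l : R) x y :
  minus x (plus (scal l x) (scal (1 - l) y)) = scal (1 - l) (minus x y).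
Proof.
apply inner_ext; intros w.
rewrite inner_minus_l, inner_plus_l, !inner_scal_l, inner_minus_l; ring.
Qed.

Lemma convex_comb_idem (l : R) x : plus (scal l x) (scal (1 - l) x) = x.
Proof. apply inner_ext; intros w; rewrite inner_plus_l, !inner_scal_l; ring. Qed.

(** * Weak cluster points: closed convex sets and demiclosedness *)

Lemma closed_approx C x :
  closed C -> (forall eps, 0 < eps -> exists c, C c /\ norm (minus c x) < eps) ->
  C x.
Proof.
intros Ccl Happ; apply Ccl; intros [eps Heps].
destruct (Happ eps (cond_pos eps)) as [c [Cc Hc]].
apply (Heps c); [now apply (norm_compat1 x c eps) | exact Cc].
Qed.

Lemma is_lim_seq_0_inv (u : nat -> R) (eps : R) :
  is_lim_seq u 0 -> 0 < eps ->
  exists n0, forall n, (n0 <= n)%nat -> Rabs (u n) < eps.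
Proof.
intros Hu Heps.
destruct (proj2 (is_lim_seq_spec u 0) Hu (mkposreal eps Heps)) as [n0 Hn0].
exists n0; intros n Hn; specialize (Hn0 n Hn); simpl in Hn0.
now rewrite Rminus_0_r in Hn0.
Qed.

(* For an almost nearest point [c] of [C] to [x], minimality tested along the
   segment from [c] to [z n] gives a positive lower bound of
   [<z n - x, c - x>] that is uniform over the bounded sequence. *)
Lemma weak_cluster_point_closed_convex C (z : nat -> H) x :
  closed C -> convex C -> (forall n, C (z n)) -> bounded_seq z ->
  weak_cluster_point z x -> C x.
Proof.
intros Ccl Ccv Cz [M HM] Hx.
apply closed_approx; [exact Ccl|]; intros eps Heps.
apply NNPP; intros Hno.
assert (Hfar : forall c, C c -> eps <= norm (minus c x)).
{ intros c Cc; apply Rnot_lt_le; intros Hlt; apply Hno; now exists c. }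
(* Distances are negated because [completeness] yields suprema; [d] below is the squared distance
   from [x] to [C]. *)
set (E := fun r => exists c, C c /\ r = - norm (minus c x) ^ 2).
destruct (completeness E) as [m [Hub Hlub]].
{ exists 0; intros r [c [_ ->]]; assert (H2 := pow2_ge_0 (norm (minus c x))); lra. }
{ exists (- norm (minus (z O) x) ^ 2), (z O); now split. }
set (d := - m).
assert (Hd : forall c, C c -> d <= norm (minus c x) ^ 2).
{ intros c Cc; unfold d.
  assert (H1 : - norm (minus c x) ^ 2 <= m) by (apply Hub; now exists c). lra. }
assert (Hd0 : 0 < d).
{ unfold d; assert (H1 : m <= - eps ^ 2).
  { apply Hlub; intros r [c [Cc ->]].
    assert (H1 := pow_incr eps _ 2 (conj (Rlt_le _ _ Heps) (Hfar c Cc))). lra. }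
  nra. }
(* [K] bounds the distance from [z n] to [c]. The step [l < 1] satisfies [l * (1 + K ^ 2) <= d];
   since [c] is nearest up to [l ^ 2], all errors in the segment test are quadratic in [l], and
   dividing by [2 * l] leaves a loss of at most [d / 2]. *)
set (K := M + norm x + d + 1).
set (l := d / (1 + d + K ^ 2)).
assert (HK := pow2_ge_0 K).
assert (Hl : l * (1 + d + K ^ 2) = d) by (unfold l; field; lra).
assert (Hl0 : 0 < l) by (apply Rdiv_lt_0_compat; lra).
assert (Hl1 : l < 1) by nra.
assert (Hc : exists c, C c /\ norm (minus c x) ^ 2 < d + l ^ 2).
{ apply NNPP; intros Hc; assert (H1 : m <= - (d + l ^ 2)).
  { apply Hlub; intros r [c [Cc ->]]; apply Ropp_le_contravar, Rnot_lt_le.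
    intros H1; apply Hc; now exists c. }
  unfold d in H1; nra. }
destruct Hc as [c [Cc Hc]].
assert (Hcx : norm (minus c x) <= d + 1).
{ assert (H1 := norm_ge_0 (minus c x)); nra. }
(* One index in this weak neighbourhood suffices: the segment test gives <z n - x, c - x> >= d - d /
   2 for every [n]. *)
destruct (Hx (fun w => Rabs (inner (minus w x) (minus c x)) < d / 2))
  with (n0 := O) as [n [_ Hn]].
{ exists (minus c x :: nil), (d / 2); split; [lra|].
  intros w Hw; apply Hw; now left. }
assert (Hzc : norm (minus (z n) c) ^ 2 <= K ^ 2).
{ apply pow_incr; split; [apply norm_ge_0|].
  assert (H1 := norm_minus_triangle (z n) x c).
  assert (H2 := norm_minus_le (z n) x).
  rewrite (norm_minus_sym x c) in H1; specialize (HM n); unfold K; lra. }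
assert (Hseg := Hd _ (Ccv _ _ l (Cz n) Cc (conj (Rlt_le _ _ Hl0) (Rlt_le _ _ Hl1)))).
rewrite norm_convex_comb_sqr, (norm_minus_sqr_shift (z n) c x) in Hseg.
assert (Hin : inner (minus (z n) x) (minus c x) =
  inner (minus (z n) c) (minus c x) + norm (minus c x) ^ 2).
{ rewrite <- inner_norm, !inner_minus_l; ring. }
assert (HI : - d / 2 <= inner (minus (z n) c) (minus c x)).
{ assert (H1 : 0 <= l ^ 2 * (K ^ 2 - norm (minus (z n) c) ^ 2))
    by (apply Rmult_le_pos; [apply pow2_ge_0 | lra]).
  assert (H2 : 0 <= l * (l * (1 + K ^ 2) + 2 * inner (minus (z n) c) (minus c x)))
    by nra.
  apply Rmult_le_reg_l with (2 * l); [lra|]; nra. }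
apply Rabs_def2 in Hn; specialize (Hd c Cc); lra.
Qed.

(** Opial's argument: nonexpansiveness keeps [z n] almost as close to [S_ x] as to [x], whereas |z n
    - S_ x|^2 exceeds |z n - x|^2 by |x - S_ x|^2 up to a cross term that is small in a weak
    neighbourhood of [x]. *)
Lemma demiclosed C (S_ : H -> H) (z : nat -> H) x :
  nonexpansive C S_ -> (forall n, C (z n)) -> bounded_seq z ->
  is_lim_seq (fun n => norm (minus (z n) (S_ (z n)))) 0 ->
  C x -> weak_cluster_point z x -> S_ x = x.
Proof.
intros [_ HS] Cz [M HM] Hlim Cx Hx.
set (D := norm (minus x (S_ x)) ^ 2).
assert (HD : D = 0).
{ destruct (pow2_ge_0 (norm (minus x (S_ x)))) as [HD|HD]; fold D in HD; [|easy].
  exfalso.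
  (* For a residual [del] below 1 and [D / (2 * K)], the excess del^2 + 2 del |z n - x| is at most
     [del * K < D / 2]. The cross term, below [D / 4] before doubling, takes the other half of
     [D]. *)
  set (K := 2 * (M + norm x) + 1).
  assert (Hx0 := norm_ge_0 x).
  assert (HM0 : 0 <= M) by (apply Rle_trans with (2 := HM O), norm_ge_0).
  assert (HK : 0 < 2 * K) by (unfold K; lra).
  destruct (is_lim_seq_0_inv _ (Rmin 1 (D / (2 * K))) Hlim) as [n0 Hn0].
  { apply Rmin_pos; [lra | now apply Rdiv_lt_0_compat]. }
  destruct (Hx (fun w => Rabs (inner (minus w x) (minus x (S_ x))) < D / 4))
    with (n0 := n0) as [n [Hn Hw]].
  { exists (minus x (S_ x) :: nil), (D / 4); split; [lra|].
    intros w Hw; apply Hw; now left. }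
  specialize (Hn0 n Hn).
  set (del := norm (minus (z n) (S_ (z n)))) in *.
  assert (Hdel : 0 <= del) by apply norm_ge_0.
  rewrite (Rabs_pos_eq _ Hdel) in Hn0.
  assert (H1 := Rlt_le_trans _ _ _ Hn0 (Rmin_l _ _)).
  assert (H2 := Rlt_le_trans _ _ _ Hn0 (Rmin_r _ _)).
  assert (H3 : del * (2 * K) < D) by now apply Rlt_div_r.
  assert (H4 := norm_minus_le (z n) x).
  assert (H6 := norm_minus_triangle (z n) (S_ (z n)) (S_ x)).
  assert (H7 := HS _ _ (Cz n) Cx).
  assert (H8 : norm (minus (z n) (S_ x)) ^ 2 <= (del + norm (minus (z n) x)) ^ 2).
  { apply pow_incr; split; [apply norm_ge_0|]. fold del in H6; lra. }
  rewrite (norm_minus_sqr_shift (z n) x (S_ x)) in H8; fold D in H8.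
  apply Rabs_def2 in Hw; specialize (HM n).
  assert (H9 := norm_ge_0 (minus (z n) x)).
  assert (H10 : 2 * norm (minus (z n) x) + 1 <= K) by (unfold K; lra).
  assert (H11 : del * (2 * norm (minus (z n) x) + 1) <= del * K)
    by now apply Rmult_le_compat_l.
  nra. }
symmetry; apply norm_minus_0, Rsqr_0_uniq; now rewrite Rsqr_pow2.
Qed.

End InnerProduct.

(** * Integral means of nonexpansive semigroups *)

Section Averages.

Variable H : HilbertSpace.
Implicit Types (x y z w p : H) (C : H -> Prop) (T : R -> H -> H).

Lemma Riemann_sum_inner (f : R -> H) (u : H) (ptd : SF_seq) :
  Riemann_sum (fun s => inner (f s) u) ptd = inner (Riemann_sum f ptd) u.
Proof.
revert ptd; apply SF_cons_ind.
- intros x0.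
  assert (E : inner (scal 0 (f 0)) u = 0) by (rewrite inner_scal_l; ring).
  assert (Z : scal 0 (f 0) = zero) by exact (scal_zero_l (f 0)).
  rewrite Z in E; exact (eq_sym E).
- intros h s IH.
  rewrite !Riemann_sum_cons, IH.
  exact (eq_sym (eq_trans (inner_plus_l _ _ _)
    (f_equal (fun r => r + _) (inner_scal_l _ _ _)))).
Qed.

Lemma is_RInt_inner (f : R -> H) (u I : H) (a b : R) :
  is_RInt f a b I -> is_RInt (fun s => inner (f s) u) a b (inner I u).
Proof.
intros Hf; unfold is_RInt in *.
apply filterlim_ext with
  (fun ptd => inner (scal (sign (b - a)) (Riemann_sum f ptd)) u).
{ intros ptd; rewrite Riemann_sum_inner; apply inner_scal_l. }
refine (filterlim_comp _ _ _ _ (fun x => inner x u) _ _ _ Hf _).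
apply (linear_cont (U := H) (V := R_NormedModule) (fun x => inner x u) I); split.
- intros x y; apply inner_plus_l.
- intros k x; apply inner_scal_l.
(* The bound of a linear map must be strictly positive, and [u] may be zero. *)
- exists (norm u + 1); split; [assert (Hu := norm_ge_0 u); lra|]; intros x.
  apply Rle_trans with (1 := Rabs_inner_le_norm H x u).
  rewrite Rmult_comm; apply Rmult_le_compat_r; [apply norm_ge_0 | lra].
Qed.

(** Prepending a cell averages its sample value with the mean of the remaining cells, weighted by
    lengths; the first conjunct keeps the weights in [0, 1]. When the total length is zero the
    weight is undefined, but both sides vanish and the old [c] serves. *)
Lemma Riemann_sum_convex C (f : R -> H) (ptd : SF_seq) :
  convex C -> (forall s, C (f s)) -> pointed_subdiv ptd ->
  SF_h ptd <= seq.last (SF_h ptd) (SF_lx ptd) /\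
  exists c, C c /\
    Riemann_sum f ptd = scal (seq.last (SF_h ptd) (SF_lx ptd) - SF_h ptd) c.
Proof.
intros Ccv Cf; revert ptd; apply (SF_cons_ind (fun ptd => pointed_subdiv ptd -> _)).
- intros x0 _; split; [apply Rle_refl|]; exists (f 0); split; [easy|].
  unfold Riemann_sum; simpl; rewrite Rminus_diag.
  exact (eq_sym (scal_zero_l (f 0))).
- intros h s IH Hp.
  destruct (IH (ptd_cons _ _ Hp)) as [Hle [c [Cc Hc]]].
  assert (Hh : fst h <= SF_h s).
  { destruct (Hp O) as [H1 H2]; [rewrite SF_size_cons; lia|]; simpl in H1, H2.
    exact (Rle_trans _ _ _ H1 H2). }
  rewrite Riemann_sum_cons, Hc, SF_lx_cons.
  change (SF_h (SF_cons h s)) with (fst h).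
  change (seq.last (fst h) (fst h :: SF_lx s))
    with (seq.last (SF_h s) (SF_lx s)).
  set (e := seq.last (SF_h s) (SF_lx s)) in *.
  split; [lra|].
  destruct (Rle_lt_or_eq_dec (fst h) e) as [Hlt|Heq]; [lra| |].
  + set (l := (SF_h s - fst h) / (e - fst h)).
    exists (plus (scal l (f (snd h))) (scal (1 - l) c)); split.
    * apply Ccv; [easy | easy |]; unfold l; split.
      -- apply Rdiv_le_0_compat; lra.
      -- apply Rle_div_l; lra.
    * apply inner_ext; intros w.
      rewrite inner_scal_l, !inner_plus_l, !inner_scal_l.
      unfold l; field; lra.
  + exists c; split; [easy|].
    apply inner_ext; intros w.
    replace (SF_h s) with e by lra; rewrite Heq.
    rewrite inner_plus_l, !inner_scal_l; ring.
Qed.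

(** Each Riemann sum divided by [b - a] lies in [C] by convexity, and closedness passes this to the
    limit. *)
Lemma RInt_mean_convex C (f : R -> H) (a b : R) (I : H) :
  closed C -> convex C -> (forall s, C (f s)) -> a < b ->
  is_RInt f a b I -> C (scal (/ (b - a)) I).
Proof.
intros Ccl Ccv Cf Hab HI.
apply (closed_filterlim_loc (F := Riemann_fine a b)
  (fun ptd => scal (/ (b - a)) (scal (sign (b - a)) (Riemann_sum f ptd)))).
- exact (filterlim_comp _ _ _ _ (fun x => scal (/ (b - a)) x) _ _ _ HI
    (filterlim_scal_r (V := H) _ _)).
- exists (mkposreal 1 Rlt_0_1); intros ptd _ [Hp [Hh Hl]].
  destruct (Riemann_sum_convex C f ptd Ccv Cf Hp) as [_ [c [Cc Hc]]].
  rewrite Hl, Hh, Rmin_left, Rmax_right in Hc by lra.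
  rewrite Hc, sign_eq_1 by lra.
  assert (E : scal (/ (b - a)) (scal 1 (scal (b - a) c)) = c).
  { apply inner_ext; intros w; rewrite !inner_scal_l; field; lra. }
  now rewrite E.
- exact Ccl.
Qed.

(* Extending an orbit by its initial value to negative times makes it
   continuous on all of R, as [ex_RInt_continuous] demands. *)
Lemma continuous_orbit C T x (r : R) :
  nonexpansive_semigroup C T -> C x -> continuous (fun s => T (Rmax 0 s) x) r.
Proof.
intros [_ [_ [_ [Hc _]]]] Cx P HP.
destruct (Hc x Cx (Rmax 0 r) (Rmax_l 0 r) P HP) as [eps Heps].
exists eps; intros s Hs; apply Heps; [|apply Rmax_l].
apply Rle_lt_trans with (2 := Hs).
change (Rabs (Rmax 0 s - Rmax 0 r) <= Rabs (s - r)).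
unfold Rmax, Rabs; repeat destruct Rle_dec; repeat destruct Rcase_abs; lra.
Qed.

(** Links [time_average] to the continuous extension of the orbit, which agrees with it on [0, t];
    the factor [t] undoes the division in the mean. *)
Lemma is_RInt_orbit C T x (t : R) :
  nonexpansive_semigroup C T -> C x -> 0 < t ->
  is_RInt (fun s => T (Rmax 0 s) x) 0 t (scal t (time_average T t x)).
Proof.
intros HT Cx Ht.
assert (HI : ex_RInt (fun s => T (Rmax 0 s) x) 0 t).
{ apply (ex_RInt_continuous (V := H)); intros z _.
  now apply continuous_orbit with C. }
apply RInt_correct in HI.
assert (E : scal t (time_average T t x) = RInt (fun s => T (Rmax 0 s) x) 0 t).
{ apply inner_ext; intros w; unfold time_average.
  rewrite !inner_scal_l.
  rewrite (RInt_ext (fun s => T s x) (fun s => T (Rmax 0 s) x)).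
  - field; lra.
  - intros s Hs; rewrite Rmin_left, Rmax_right in Hs by lra.
    now rewrite Rmax_right by lra. }
now rewrite E.
Qed.

Lemma self_map_time_average C T (t : R) :
  closed C -> convex C -> nonexpansive_semigroup C T -> 0 < t ->
  self_map C (time_average T t).
Proof.
intros Ccl Ccv HT Ht x Cx.
assert (Hm := RInt_mean_convex C _ _ _ _ Ccl Ccv
  (fun s => proj1 HT _ (Rmax_l 0 s) x Cx) Ht (is_RInt_orbit C T x t HT Cx Ht)).
assert (E : time_average T t x = scal (/ (t - 0)) (scal t (time_average T t x))).
{ apply inner_ext; intros w; rewrite !inner_scal_l; field; lra. }
now rewrite E.
Qed.

Lemma nonexpansive_time_average C T (t : R) :
  closed C -> convex C -> nonexpansive_semigroup C T -> 0 < t ->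
  nonexpansive C (time_average T t).
Proof.
intros Ccl Ccv HT Ht; split; [now apply self_map_time_average|].
intros x y Cx Cy.
assert (HI := is_RInt_minus _ _ _ _ _ _ (is_RInt_orbit C T x t HT Cx Ht)
  (is_RInt_orbit C T y t HT Cy Ht)).
apply norm_RInt_le_const with (M := norm (minus x y)) in HI.
- assert (E : norm (minus (scal t (time_average T t x)) (scal t (time_average T t y)))
    = Rabs t * norm (minus (time_average T t x) (time_average T t y))).
  { rewrite <- norm_scal_eq; f_equal.
    apply inner_ext; intros w.
    rewrite inner_minus_l, !inner_scal_l, inner_minus_l; ring. }
  rewrite Rabs_pos_eq in E by lra.
  apply Rmult_le_reg_l with (1 := Ht); rewrite <- E.
  rewrite Rminus_0_r in HI; exact HI.
- lra.
- intros s Hs; apply HT; [apply Rmax_l | easy | easy].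
Qed.

Lemma time_average_fixed T p (t : R) :
  0 < t -> (forall s, 0 <= s -> T s p = p) -> time_average T t p = p.
Proof.
intros Ht Hp; unfold time_average.
rewrite (RInt_ext _ (fun _ => p)), RInt_const.
- apply inner_ext; intros w.
  assert (E : inner (scal (/ t) (scal (t - 0) p)) w = inner p w)
    by (rewrite !inner_scal_l; field; lra).
  exact E.
- intros s Hs; rewrite Rmin_left in Hs by lra; apply Hp; lra.
Qed.

(* The mean [y] of the orbit satisfies
   [int |T r x - w|^2 = int |T r x - y|^2 + t |y - w|^2] for every [w]; for
   [w = T s y], shifting time by [s] bounds the left side by
   [int |T r x - y|^2] up to the contribution of [0, s]. *)
Lemma time_average_almost_fixed C T x p (s t : R) :
  closed C -> convex C -> nonexpansive_semigroup C T -> C x -> C p ->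
  (forall r, 0 <= r -> T r p = p) -> 0 <= s <= t -> 0 < t ->
  t * norm (minus (time_average T t x) (T s (time_average T t x))) ^ 2
  <= s * (2 * norm (minus x p)) ^ 2.
Proof.
intros Ccl Ccv HT Cx Cp Hp Hs Ht.
set (y := time_average T t x).
assert (Cy : C y) by now apply self_map_time_average.
assert (Hy : norm (minus y p) <= norm (minus x p)).
{ assert (H1 := proj2 (nonexpansive_time_average C T t Ccl Ccv HT Ht) x p Cx Cp).
  now rewrite (time_average_fixed T p t Ht Hp) in H1. }
destruct HT as [Tself [T0 [Tadd [Tcont Tne]]]].
assert (HT : nonexpansive_semigroup C T) by now repeat split.
assert (Cw : C (T s y)) by now apply Tself.
set (w := T s y) in *.
set (g := fun r => T (Rmax 0 r) x).
set (phi := fun q r => norm (minus (g r) q) ^ 2).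
assert (Hcont : forall q r, continuous (phi q) r).
{ intros q r; unfold phi; simpl.
  assert (Hn : continuous (fun r => norm (minus (g r) q)) r).
  { apply (continuous_comp (fun r => minus (g r) q) norm).
    - apply (continuous_minus (V := H)); [|apply continuous_const].
      now apply continuous_orbit with C.
    - exact (filterlim_norm (V := H) _). }
  apply (continuous_mult (K := R_AbsRing)); [exact Hn|].
  apply (continuous_mult (K := R_AbsRing)); [exact Hn | apply continuous_const]. }
assert (Hex : forall q u v, ex_RInt (phi q) u v).
{ intros q u v; apply (ex_RInt_continuous (V := R_CompleteNormedModule)); auto. }
assert (Hmean : RInt (phi w) 0 t = RInt (phi y) 0 t + t * norm (minus y w) ^ 2).
{ assert (Hin := is_RInt_inner g (minus y w) _ 0 t (is_RInt_orbit C T x t HT Cx Ht)).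
  apply is_RInt_unique.
  (* Expand |g r - w|^2 around [y]. The cross term 2 <g r - y, y - w> is affine in [g r] and
     integrates to zero because [y] is the mean. *)
  apply is_RInt_ext with (fun r => phi y r +
    (2 * inner (g r) (minus y w)
     + (norm (minus y w) ^ 2 - 2 * inner y (minus y w)))).
  { intros r _; apply Rminus_diag_uniq; unfold phi.
    rewrite (norm_minus_sqr_shift _ (g r) y w), inner_minus_l; ring. }
  replace (RInt (phi y) 0 t + t * norm (minus y w) ^ 2) with
    (RInt (phi y) 0 t + (2 * inner (scal t (time_average T t x)) (minus y w)
      + (t - 0) * (norm (minus y w) ^ 2 - 2 * inner y (minus y w)))).
  2: { fold y; rewrite inner_scal_l; ring. }
  apply (is_RInt_plus (V := R_NormedModule)).
  { now apply (RInt_correct (V := R_CompleteNormedModule)). }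
  apply (is_RInt_plus (V := R_NormedModule)).
  { exact (is_RInt_scal (V := R_NormedModule) _ 0 t 2 _ Hin). }
  exact (is_RInt_const (V := R_NormedModule) 0 t _). }
assert (Hsplit : RInt (phi w) 0 s + RInt (phi w) s t = RInt (phi w) 0 t)
  by exact (RInt_Chasles (V := R_CompleteNormedModule) _ _ _ _ (Hex _ _ _) (Hex _ _ _)).
assert (Hsplit' : RInt (phi y) 0 (t - s) + RInt (phi y) (t - s) t = RInt (phi y) 0 t)
  by exact (RInt_Chasles (V := R_CompleteNormedModule) _ _ _ _ (Hex _ _ _) (Hex _ _ _)).
(* Both [g r] and [w] lie within |x - p| of the fixed point [p], hence within twice that of each
   other. *)
assert (Hinit : RInt (phi w) 0 s <= s * (2 * norm (minus x p)) ^ 2).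
{ replace (s * (2 * norm (minus x p)) ^ 2)
    with (RInt (fun _ => (2 * norm (minus x p)) ^ 2) 0 s).
  2: { rewrite RInt_const; unfold scal; simpl; unfold mult; simpl; ring. }
  apply RInt_le; [lra | auto | apply ex_RInt_const |].
  intros r _; unfold phi; apply pow_incr; split; [apply norm_ge_0|].
  assert (H1 := norm_minus_triangle _ (g r) p w).
  assert (H2 := Tne (Rmax 0 r) x p (Rmax_l _ _) Cx Cp).
  rewrite Hp in H2 by apply Rmax_l.
  assert (H3 := Tne s y p (proj1 Hs) Cy Cp).
  rewrite Hp in H3 by lra.
  rewrite (norm_minus_sym _ p w) in H1; fold (g r) in H2; fold w in H3; lra. }
(* By the semigroup law the orbit at time [r + s] is [T s] of the orbit at time [r], so it is no
   farther from [T s y] than the latter is from [y]. *)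
assert (Hshift : RInt (phi w) s t <= RInt (phi y) 0 (t - s)).
{ assert (E : RInt (fun r => scal 1 (phi w (1 * r + s))) 0 (t - s) = RInt (phi w) s t).
  { rewrite (RInt_comp_lin (V := R_CompleteNormedModule)); [|auto].
    f_equal; ring. }
  rewrite <- E; apply RInt_le; [lra | | auto |].
  - apply (ex_RInt_comp_lin (V := R_NormedModule)); auto.
  - intros r Hr; unfold scal; simpl; unfold mult; simpl.
    rewrite !Rmult_1_l; unfold phi; apply pow_incr; split; [apply norm_ge_0|].
    unfold g, w; rewrite !Rmax_right by lra.
    rewrite (Rplus_comm r s), (Tadd s r) by (easy || lra).
    apply Tne; [lra | apply Tself; [lra | easy] | easy]. }
assert (Hpos : 0 <= RInt (phi y) (t - s) t).
{ apply RInt_ge_0; [lra | auto |]; intros r _; apply pow2_ge_0. }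
lra.
Qed.

End Averages.

(** * Asymptotic regularity of the composed averages *)

Lemma is_lim_seq_0_squeeze (u v : nat -> R) :
  eventually (fun n => 0 <= u n <= v n) -> is_lim_seq v 0 -> is_lim_seq u 0.
Proof.
intros Huv Hv; apply is_lim_seq_le_le_loc with (u := fun _ => 0) (w := v).
- exact Huv.
- apply is_lim_seq_const.
- exact Hv.
Qed.

Lemma is_lim_seq_sqr_0 (u : nat -> R) :
  (forall n, 0 <= u n) -> is_lim_seq (fun n => u n ^ 2) 0 -> is_lim_seq u 0.
Proof.
intros Hu Hlim; apply is_lim_seq_ext with (fun n => sqrt (u n ^ 2)).
- intros n; now apply sqrt_pow2.
- rewrite <- sqrt_0; apply is_lim_seq_continuous; [|exact Hlim].
  apply continuity_pt_sqrt, Rle_refl.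
Qed.

Lemma is_lim_seq_scal_0 (c : R) (u : nat -> R) :
  is_lim_seq u 0 -> is_lim_seq (fun n => c * u n) 0.
Proof.
intros Hu; rewrite <- (Rmult_0_r c); exact (is_lim_seq_scal_l u c 0 Hu).
Qed.

Lemma is_lim_seq_plus_0 (u v : nat -> R) :
  is_lim_seq u 0 -> is_lim_seq v 0 -> is_lim_seq (fun n => u n + v n) 0.
Proof.
intros Hu Hv; rewrite <- (Rplus_0_r 0); exact (is_lim_seq_plus' u v 0 0 Hu Hv).
Qed.

Section Regularity.

Variable H : HilbertSpace.
Implicit Types (x y z w p : H) (C : H -> Prop) (T : R -> H -> H).

Lemma nonexpansive_relaxation C (A G : H -> H) (l : R) :
  convex C -> nonexpansive C A -> nonexpansive C G -> 0 <= l <= 1 ->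
  nonexpansive C (fun x => plus (scal l x) (scal (1 - l) (A (G x)))).
Proof.
intros Ccv [HA HA'] [HG HG'] Hl; split.
- intros x Cx; apply Ccv; auto.
- intros x y Cx Cy.
  assert (E : minus (plus (scal l x) (scal (1 - l) (A (G x))) : H)
                    (plus (scal l y) (scal (1 - l) (A (G y)))) =
    plus (scal l (minus x y)) (scal (1 - l) (minus (A (G x)) (A (G y))))).
  { apply inner_ext; intros w.
    rewrite inner_minus_l, !inner_plus_l, !inner_scal_l, !inner_minus_l; ring. }
  cbv beta; rewrite E.
  assert (H1 : norm (plus (scal l (minus x y))
                          (scal (1 - l) (minus (A (G x)) (A (G y))))) <=
    norm (scal l (minus x y)) + norm (scal (1 - l) (minus (A (G x)) (A (G y)))))
    by exact (norm_triangle _ _).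
  rewrite !norm_scal_eq, !Rabs_pos_eq in H1 by lra.
  assert (H2 := HA' _ _ (HG x Cx) (HG y Cy)).
  assert (H3 := HG' x y Cx Cy).
  assert (H4 : (1 - l) * norm (minus (A (G x)) (A (G y))) <= (1 - l) * norm (minus x y))
    by (apply Rmult_le_compat_l; lra).
  lra.
Qed.

Lemma nonexpansive_Gamma_rec C (A : nat -> H -> H) (alpha : nat -> R) (k j : nat) :
  convex C ->
  (forall i, (j <= i < j + k)%nat -> nonexpansive C (A i) /\ 0 <= alpha i <= 1) ->
  nonexpansive C (Gamma_rec A alpha k j).
Proof.
intros Ccv; revert j; induction k as [|k IH]; intros j HA.
- split; [now intros x Cx | intros x y _ _; apply Rle_refl].
- apply nonexpansive_relaxation; [exact Ccv | apply HA; lia | | apply HA; lia].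
  apply IH; intros i Hi; apply HA; lia.
Qed.

Lemma Gamma_rec_fixed (A : nat -> H -> H) (alpha : nat -> R) (k j : nat) p :
  (forall i, (j <= i < j + k)%nat -> A i p = p) -> Gamma_rec A alpha k j p = p.
Proof.
revert j; induction k as [|k IH]; intros j HA; simpl; [easy|].
rewrite IH, HA by (try intros i Hi; try apply HA; lia).
apply convex_comb_idem.
Qed.

(** The outermost step alone gives the decrease: with [l] its coefficient, the convexity identity
    gains [l * (1 - l)] times |x - A j (G x)|^2, the squared residual is [(1 - l) ^ 2] times the
    same quantity, and [a <= l] gives [a * (1 - l) ^ 2 <= l * (1 - l)]. *)
Lemma Gamma_rec_descent C (A : nat -> H -> H) (alpha : nat -> R) (k j : nat) (a : R) x p :
  convex C -> 0 <= a ->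
  (forall i, (j <= i < j + k)%nat -> nonexpansive C (A i) /\ A i p = p /\ a <= alpha i <= 1) ->
  C x -> C p ->
  a * norm (minus x (Gamma_rec A alpha k j x)) ^ 2
  <= norm (minus x p) ^ 2 - norm (minus (Gamma_rec A alpha k j x) p) ^ 2.
Proof.
intros Ccv Ha HA Cx Cp.
destruct k as [|k]; simpl Gamma_rec.
- rewrite <- (inner_norm (minus x x)), inner_minus_l; lra.
- set (G := Gamma_rec A alpha k (S j)).
  assert (HG : nonexpansive C G).
  { apply nonexpansive_Gamma_rec; [exact Ccv|]; intros i Hi.
    destruct (HA i) as [H1 [_ H2]]; [lia|]; split; [exact H1 | lra]. }
  destruct (HA j) as [[HAs HAn] [HAp Hal]]; [lia|].
  assert (Hp : G p = p) by (apply Gamma_rec_fixed; intros i Hi; apply HA; lia).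
  set (l := alpha j) in *.
  rewrite minus_convex_comb, norm_scal_eq, Rabs_pos_eq, norm_convex_comb_sqr by lra.
  assert (H1 := HAn _ _ (proj1 HG x Cx) Cp); rewrite HAp in H1.
  assert (H2 := proj2 HG x p Cx Cp); rewrite Hp in H2.
  assert (H3 : norm (minus (A j (G x)) p) ^ 2 <= norm (minus x p) ^ 2)
    by (apply pow_incr; split; [apply norm_ge_0 | lra]).
  assert (H4 : (1 - l) * norm (minus (A j (G x)) p) ^ 2 <= (1 - l) * norm (minus x p) ^ 2)
    by (apply Rmult_le_compat_l; lra).
  assert (H5 : a * (1 - l) ^ 2 <= l * (1 - l)).
  { assert (H6 : 0 <= (1 - l) * (l - a + a * l)) by (apply Rmult_le_pos; nra). lra. }
  assert (H6 := Rmult_le_compat_r _ _ _ (pow2_ge_0 (norm (minus x (A j (G x))))) H5).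
  rewrite Rpow_mult_distr; lra.
Qed.

(* Peeling off the outermost step: [z n] is close to [A j (G (z n))], where
   [G] is the inner composition; hence [G (z n)] is asymptotically no closer to
   [p] than [z n], and [Gamma_rec_descent] forces [z n - G (z n)] to 0. *)
Lemma Gamma_rec_residual C (A : nat -> nat -> H -> H) (alpha : nat -> nat -> R)
    (a b : R) (z : nat -> H) p (k j : nat) :
  convex C -> 0 < a -> b < 1 ->
  (forall n i, (j <= i < j + k)%nat -> nonexpansive C (A n i) /\ A n i p = p) ->
  (forall n i, (j < i < j + k)%nat -> a < alpha i n < b) ->
  (forall n, (0 < k)%nat -> 0 <= alpha j n < b) ->
  C p -> (forall n, C (z n)) -> bounded_seq z ->
  is_lim_seq (fun n => norm (minus (z n)
    (Gamma_rec (A n) (fun i => alpha i n) k j (z n)))) 0 ->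
  forall i, (j <= i < j + k)%nat ->
  is_lim_seq (fun n => norm (minus (z n) (A n i (z n)))) 0.
Proof.
intros Ccv Ha Hb HA Hal Halj Cp Cz Hz.
revert j HA Hal Halj; induction k as [|k IH]; intros j HA Hal Halj Hlim i Hi; [lia|].
simpl Gamma_rec in Hlim.
set (G := fun n => Gamma_rec (A n) (fun i => alpha i n) k (S j)) in *.
assert (HG : forall n, nonexpansive C (G n)).
{ intros n; apply nonexpansive_Gamma_rec; [exact Ccv|]; intros i' Hi'; split.
  - apply HA; lia.
  - assert (H1 := Hal n i'); destruct H1; [lia | lra]. }
(* The whole residual is [1 - alpha j n > 1 - b] times this norm, so an outermost coefficient equal
   to 0 does no harm. *)
assert (HAG : is_lim_seq (fun n => norm (minus (z n) (A n j (G n (z n))))) 0).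
{ apply is_lim_seq_0_squeeze with (2 := is_lim_seq_scal_0 (/ (1 - b)) _ Hlim).
  exists O; intros n _; split; [apply norm_ge_0|].
  assert (Hn := Halj n (Nat.lt_0_succ k)).
  fold (G n); rewrite minus_convex_comb, norm_scal_eq, Rabs_pos_eq by lra.
  assert (H1 := norm_ge_0 (minus (z n) (A n j (G n (z n))))).
  apply Rmult_le_reg_l with (1 - b); [lra|].
  rewrite <- Rmult_assoc, Rinv_r, Rmult_1_l by lra.
  apply Rmult_le_compat_r; lra. }
assert (HzG : is_lim_seq (fun n => norm (minus (z n) (G n (z n)))) 0).
{ destruct Hz as [M HM].
  apply is_lim_seq_sqr_0; [intros n; apply norm_ge_0|].
  (* With [u], [v] the distances of [z n] and [G n (z n)] to [p] and [e] the norm in [HAG], descent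
     bounds a |z n - G n (z n)|^2 by u^2 - v^2 <= 2 u e, and [u <= M + norm p]. *)
  apply is_lim_seq_0_squeeze
    with (2 := is_lim_seq_scal_0 (2 * (M + norm p) / a) _ HAG).
  exists O; intros n _; split; [apply pow2_ge_0|].
  assert (Hd := Gamma_rec_descent C (A n) (fun i => alpha i n) k (S j) a (z n) p Ccv).
  fold (G n) in Hd.
  lapply Hd; [clear Hd; intros Hd | lra].
  lapply Hd; [clear Hd; intros Hd |].
  2: { intros i' Hi'; destruct (HA n i') as [H1 H2]; [lia|].
       destruct (Hal n i') as [H3 H4]; [lia|]; repeat split; (apply H1 || easy || lra). }
  specialize (Hd (Cz n) Cp).
  destruct (HA n j) as [[_ HAn] HAp]; [lia|].
  assert (H1 := HAn _ _ (proj1 (HG n) _ (Cz n)) Cp); rewrite HAp in H1.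
  assert (H2 := norm_minus_triangle _ (z n) (A n j (G n (z n))) p).
  assert (H3 := norm_ge_0 (minus (G n (z n)) p)).
  assert (H4 := norm_ge_0 (minus (z n) (A n j (G n (z n))))).
  assert (H5 := norm_minus_le _ (z n) p).
  specialize (HM n).
  set (u := norm (minus (z n) p)) in *.
  set (v := norm (minus (G n (z n)) p)) in *.
  set (e := norm (minus (z n) (A n j (G n (z n))))) in *.
  assert (H0 := norm_ge_0 (minus (z n) p)); fold u in H0.
  (* If [u <= v] the left side is nonpositive; otherwise [u - v <= e] and [u + v <= 2 * u]. *)
  assert (H7 : u ^ 2 - v ^ 2 <= 2 * u * e).
  { assert (H7 : (u - v) * (u + v) <= e * (u + v)) by (apply Rmult_le_compat_r; lra).
    destruct (Rle_lt_dec u v) as [H8|H8]; nra. }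
  assert (H8 : u * e <= (M + norm p) * e) by (apply Rmult_le_compat_r; lra).
  apply Rmult_le_reg_l with (1 := Ha).
  replace (a * (2 * (M + norm p) / a * e)) with (2 * ((M + norm p) * e)) by (field; lra).
  lra. }
destruct (Nat.eq_dec i j) as [->|Hij].
- apply is_lim_seq_0_squeeze with (2 := is_lim_seq_plus_0 _ _ HAG HzG).
  exists O; intros n _; split; [apply norm_ge_0|].
  destruct (HA n j) as [[_ HAn] _]; [lia|].
  assert (H1 := HAn _ _ (proj1 (HG n) _ (Cz n)) (Cz n)).
  rewrite (norm_minus_sym _ (G n (z n)) (z n)) in H1.
  assert (H2 := norm_minus_triangle _ (z n) (A n j (G n (z n))) (A n j (z n))).
  lra.
- apply IH with (j := S j); [| | | exact HzG | lia].
  + intros n i' Hi'; apply HA; lia.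
  + intros n i' Hi'; apply Hal; lia.
  (* The next outermost coefficient lies in (a, b), which is stronger than the range [0, b) asked at
     that place. *)
  + intros n Hk; destruct (Hal n (S j)); [lia | lra].
Qed.

(** The mean [y n] is almost fixed by [T s], with squared error of order [s / t n], and [z n] is
    asymptotic to [y n]. *)
Lemma almost_fixed_of_time_average C T (t : nat -> R) (z : nat -> H) p (s : R) :
  closed C -> convex C -> nonexpansive_semigroup C T ->
  C p -> (forall r, 0 <= r -> T r p = p) ->
  (forall n, 0 < t n) -> is_lim_seq t p_infty ->
  (forall n, C (z n)) -> bounded_seq z -> 0 <= s ->
  is_lim_seq (fun n => norm (minus (z n) (time_average T (t n) (z n)))) 0 ->
  is_lim_seq (fun n => norm (minus (z n) (T s (z n)))) 0.
Proof.
intros Ccl Ccv HT Cp Hp Ht Htlim Cz [M HM] Hs Hlim.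
set (y := fun n => time_average T (t n) (z n)).
assert (Hy : is_lim_seq (fun n => norm (minus (y n) (T s (y n)))) 0).
{ apply is_lim_seq_sqr_0; [intros n; apply norm_ge_0|].
  apply is_lim_seq_0_squeeze with (v := fun n => s * (2 * (M + norm p)) ^ 2 * / t n).
  (* The estimate for the mean requires [s <= t n], so the bound holds only eventually. *)
  - destruct (proj2 (is_lim_seq_spec t p_infty) Htlim s) as [n0 Hn0].
    exists n0; intros n Hn; split; [apply pow2_ge_0|].
    assert (H1 := time_average_almost_fixed H C T (z n) p s (t n)
      Ccl Ccv HT (Cz n) Cp Hp (conj Hs (Rlt_le _ _ (Hn0 n Hn))) (Ht n)).
    assert (H2 : (2 * norm (minus (z n) p)) ^ 2 <= (2 * (M + norm p)) ^ 2).
    { apply pow_incr; assert (H2 := norm_ge_0 (minus (z n) p)).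
      assert (H5 := norm_minus_le _ (z n) p).
      specialize (HM n); lra. }
    apply (Rmult_le_compat_l s) in H2; [|exact Hs].
    fold (y n) in H1.
    apply Rmult_le_reg_l with (1 := Ht n).
    rewrite (Rmult_comm _ (/ t n)), <- Rmult_assoc, Rinv_r, Rmult_1_l.
    + lra.
    + apply Rgt_not_eq, Ht.
  - apply is_lim_seq_scal_0.
    exact (is_lim_seq_inv t p_infty Htlim ltac:(discriminate)). }
(* The factor 2 counts |z n - y n| once directly and once through [T s]. *)
apply is_lim_seq_0_squeeze
  with (2 := is_lim_seq_plus_0 _ _ (is_lim_seq_scal_0 2 _ Hlim) Hy).
exists O; intros n _; split; [apply norm_ge_0|].
assert (H1 := norm_minus_triangle _ (z n) (y n) (T s (z n))).
assert (H2 := norm_minus_triangle _ (y n) (T s (y n)) (T s (z n))).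
assert (Cy : C (y n)) by now apply self_map_time_average.
assert (H3 := proj2 (proj2 (proj2 (proj2 HT))) s (y n) (z n) Hs Cy (Cz n)).
rewrite (norm_minus_sym _ (y n) (z n)) in H3; fold (y n); lra.
Qed.

(** * Midpoints of a nonexpansive mapping and the identity *)

Lemma midpoint_fixed (S_ : H -> H) x : scal (/ 2) (plus (S_ x) x) = x -> S_ x = x.
Proof.
intros E; apply inner_ext; intros w.
assert (Ew := f_equal (fun v => inner v w) E); cbv beta in Ew.
rewrite inner_scal_l, inner_plus_l in Ew; lra.
Qed.

Lemma minus_midpoint x y : minus x (scal (/ 2) (plus y x)) = scal (/ 2) (minus x y).
Proof.
apply inner_ext; intros w.
rewrite inner_minus_l, !inner_scal_l, inner_plus_l, inner_minus_l; field.
Qed.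

(** With m the midpoint of [x] and [S_ x], <w - m, x - m> equals (|S_ x - w|^2 - |x - w|^2) / 4,
    which is nonpositive when [S_] fixes [w]. *)
Lemma T_class_midpoint C (S_ : H -> H) :
  convex C -> nonexpansive C S_ -> T_class C (fun x => scal (/ 2) (plus (S_ x) x)).
Proof.
intros Ccv [HS HS']; split.
- intros x Cx.
  assert (E : scal (/ 2) (plus (S_ x) x) =
    plus (scal (/ 2) (S_ x)) (scal (1 - / 2) x)).
  { apply inner_ext; intros w.
    rewrite inner_scal_l, !inner_plus_l, !inner_scal_l; field. }
  rewrite E; apply Ccv; [auto | auto | lra].
- intros x Cx w [Cw Hw]; apply midpoint_fixed in Hw; unfold halfspace.
  assert (Hn := HS' x w Cx Cw); rewrite Hw in Hn.
  assert (H2 := pow_incr _ _ 2 (conj (norm_ge_0 _) Hn)).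
  rewrite <- !inner_norm in H2; rewrite minus_midpoint.
  rewrite inner_scal_r, !inner_minus_l, !inner_minus_r, !inner_scal_l,
    !inner_plus_l, (inner_sym x w), (inner_sym x (S_ x)), (inner_sym w (S_ x)) in *.
  lra.
Qed.

End Regularity.

(** * NST-condition (I), class membership and coherence for the composed averages *)

Theorem proposition19 :
  forall (H : HilbertSpace) (C : H -> Prop),
  (exists x : H, C x) -> closed C -> convex C ->
  forall (N : nat), (1 <= N)%nat ->
  forall (T : nat -> R -> H -> H),
  (forall j : nat, (1 <= j <= N)%nat -> nonexpansive_semigroup C (T j)) ->
  (exists x : H, forall (j : nat) (t : R),
      (1 <= j <= N)%nat -> 0 <= t -> Fix C (T j t) x) ->
  forall (t : nat -> R),
  (forall n : nat, 0 < t n) -> is_lim_seq t p_infty ->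
  forall (a b : R), 0 < a -> a < b -> b < 1 ->
  forall (alpha : nat -> nat -> R),
  (forall j n : nat, (2 <= j <= N)%nat -> a < alpha j n < b) ->
  (forall n : nat, 0 <= alpha 1%nat n < b) ->
  let Tavg (n j : nat) : H -> H := time_average (T j) (t n) in
  let Rn (n : nat) : H -> H := Gamma (Tavg n) (fun j : nat => alpha j n) N 1 in
  let Tn (n : nat) (x : H) : H := scal (/ 2) (plus (Rn n x) x) in
  NST_condition_I C Rn
    (fun U : H -> H => exists (j : nat) (s : R),
       (1 <= j <= N)%nat /\ 0 <= s /\ U = T j s) /\
  (T_class_seq C Tn /\ coherent C Tn).
Proof.
intros H C _ Ccl Ccv N HN T HT [p Hp] t Ht Htlim a b Ha Hab Hb alpha Hal Hal1
  Tavg Rn Tn.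
assert (Cp : C p) by (apply (Hp 1%nat 0); [lia | lra]).
assert (Hp' : forall j, (1 <= j <= N)%nat -> forall r, 0 <= r -> T j r p = p)
  by (intros j Hj r Hr; now apply Hp).
assert (ERn : forall n, Rn n = Gamma_rec (Tavg n) (fun j => alpha j n) N 1).
{ intros n; unfold Rn, Gamma; now rewrite Nat.add_sub. }
assert (HTavg : forall n j, (1 <= j <= N)%nat -> nonexpansive C (Tavg n j))
  by (intros n j Hj; apply nonexpansive_time_average; auto).
assert (HRn : forall n, nonexpansive C (Rn n)).
{ intros n; rewrite ERn; apply nonexpansive_Gamma_rec; [exact Ccv|].
  intros i Hi; split; [apply HTavg; lia|].
  destruct (Nat.eq_dec i 1) as [->|Hi1]; [assert (H1 := Hal1 n); lra|].
  destruct (Hal i n); [lia | lra]. }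
assert (Hreg : forall z, (forall n, C (z n)) -> bounded_seq z ->
  is_lim_seq (fun n => norm (minus (z n) (Rn n (z n)))) 0 ->
  forall j s, (1 <= j <= N)%nat -> 0 <= s ->
  is_lim_seq (fun n => norm (minus (z n) (T j s (z n)))) 0).
{ intros z Cz Hz Hlim j s Hj Hs.
  apply almost_fixed_of_time_average with C t p; auto.
  apply (Gamma_rec_residual H C Tavg alpha a b z p N 1); auto; try lia.
  - intros n i Hi; split; [apply HTavg; lia|].
    apply time_average_fixed; [auto | apply Hp'; lia].
  - intros n i Hi; apply Hal; lia.
  - apply is_lim_seq_ext with (2 := Hlim); intros n; now rewrite ERn. }
(* A common fixed point of the [Rn n] is a constant sequence with zero residual; [Hreg] then makes
   the constant |x - T j s x| tend to 0. *)
assert (Hfix : forall x, (forall n, Fix C (Rn n) x) ->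
  forall j s, (1 <= j <= N)%nat -> 0 <= s -> T j s x = x).
{ intros x Hx j s Hj Hs; symmetry; apply norm_minus_0.
  assert (Hlim : is_lim_seq (fun _ => norm (minus x (T j s x))) 0).
  { apply (Hreg (fun _ => x)); [intros _; apply (Hx O) | now exists (norm x) | | easy | easy].
    apply is_lim_seq_ext with (2 := is_lim_seq_const 0); intros n.
    rewrite (proj2 (Hx n)); symmetry.
    apply Rsqr_0_uniq; rewrite Rsqr_pow2, <- inner_norm, inner_minus_l; ring. }
  apply is_lim_seq_unique in Hlim; rewrite Lim_seq_const in Hlim.
  now injection Hlim. }
assert (Hfix' : forall x, C x ->
  (forall j s, (1 <= j <= N)%nat -> 0 <= s -> T j s x = x) ->
  forall n, Rn n x = x).
{ intros x Cx Hx n; rewrite ERn; apply Gamma_rec_fixed; intros i Hi.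
  apply time_average_fixed; [auto|]; intros s Hs; apply Hx; [lia | exact Hs]. }
assert (HTn : T_class_seq C Tn) by (intros n; now apply T_class_midpoint).
assert (HNST : NST_condition_I C Rn
  (fun U : H -> H => exists (j : nat) (s : R),
     (1 <= j <= N)%nat /\ 0 <= s /\ U = T j s)).
{ split; [exact HRn|]; split; [|split; [|split]].
  - intros U [j [s [Hj [Hs ->]]]].
    destruct (HT j Hj) as [Tself [_ [_ [_ Tne]]]].
    split; [now apply Tself | intros x y; now apply Tne].
  - exists p; split; [exact Cp|]; intros U [j [s [Hj [Hs ->]]]]; now apply Hp.
  - intros x; split.
    + intros [Cx Hx] n; split; [exact Cx|]; apply Hfix'; [exact Cx|].
      intros j s Hj Hs; apply Hx; now exists j, s.
    + intros Hx; assert (Cx := proj1 (Hx O)); split; [exact Cx|].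
      intros U [j [s [Hj [Hs ->]]]]; split; [exact Cx | now apply Hfix].
  - intros z Cz Hz Hlim U [j [s [Hj [Hs ->]]]]; now apply Hreg. }
split; [exact HNST|]; split; [exact HTn|]; split; [exact HTn|].
intros z Cz Hz _ Hsum x Hx.
assert (Hlim : is_lim_seq (fun n => norm (minus (z n) (Rn n (z n)))) 0).
(* The residual of [Tn n] is half that of [Rn n], and summable squares tend to 0. *)
{ apply is_lim_seq_ext with (fun n => 2 * norm (minus (z n) (Tn n (z n)))).
  - intros n; unfold Tn; rewrite minus_midpoint, norm_scal_eq, Rabs_pos_eq by lra; field.
  - apply is_lim_seq_scal_0, is_lim_seq_sqr_0; [intros n; apply norm_ge_0|].
    now apply ex_series_lim_0. }
assert (Cx : C x) by now apply (weak_cluster_point_closed_convex H C z x).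
(* It remains to fix [x] by every [T j s], which demiclosedness gives; [Hfix'] transfers this to
   [Rn n], and the midpoint of [x] with itself is [x]. *)
intros n; split; [exact Cx|]; unfold Tn.
rewrite Hfix'; [|exact Cx|].
- apply inner_ext; intros w; rewrite inner_scal_l, inner_plus_l; field.
- intros j s Hj Hs; apply (demiclosed H C (T j s) z x); auto.
  destruct (HT j Hj) as [Tself [_ [_ [_ Tne]]]].
  split; [now apply Tself | intros x' y; now apply Tne].
Qed.
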